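(* Suppose $f^*$ is the global optimal value of the two-stage stochastic program $\min_{x\in X} f(x)=f_1(x)+\mathbb{E}_\mu[f_2(x,\xi)]$. If the polynomial lower approximation algorithm described in the context, run with tolerance $\epsilon\ge0$, terminates with an output pair $(\tilde{x}^*,\tilde{f}^* )$, then $$\tilde{f}^*\le f^*\le\tilde{f}^*+\epsilon,\qquad f(\tilde{x}^* )-\epsilon\le f^*\le f(\tilde{x}^* ).$$ For the special case $\epsilon=0$, we have $f^*=\tilde{f}^*$ and $\tilde{x}^*$ is a global optimal solution of the two-stage stochastic program.
   Context: Setting. Let $x\in\mathbb{R}^{n_1}$, $y\in\mathbb{R}^{n_2}$, $\xi\in\mathbb{R}^{n_0}$, and let $\mathcal{I}_0,\mathcal{I}_1,\mathcal{I}_2$ be finite, possibly empty, index sets. $f_1:\mathbb{R}^{n_1}\to\mathbb{R}$ is a function, and $g_{0,i}\in\mathbb{R}[\xi]$, $g_{1,i}\in\mathbb{R}[x]$, $g_{2,i}\in\mathbb{R}[x,y,\xi]$, $F\in\mathbb{R}[x,y,\xi]$ are polynomials. Define $X=\{x: g_{1,i}(x)\ge 0\ \forall i\in\mathcal{I}_1\}$, $S=\{\xi: g_{0,i}(\xi)\ge0\ \forall i\in\mathcal{I}_0\}$, $Y(x,\xi)=\{y: g_{2,i}(x,y,\xi)\ge 0\ \forall i\in\mathcal{I}_2\}$, and $f_2(x,\xi)=\inf_{y\in Y(x,\xi)}F(x,y,\xi)$ (with the usual convention $\inf\emptyset=+\infty$). $\mu$ is a probability measure supported on $S$; expectations appearing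 below are understood to be well defined. Let $f(x)=f_1(x)+\mathbb{E}_\mu[f_2(x,\xi)]$, $\mathcal{F}=\{(x,\xi)\in X\times S: Y(x,\xi)\neq\emptyset\}$, $K=\{(x,y,\xi):(x,\xi)\in\mathcal{F},\ y\in Y(x,\xi)\}$, and let $\mathscr{P}(K)$ be the cone of polynomials in $\mathbb{R}[x,y,\xi]$ that are nonnegative on $K$. $\delta_{a}$ denotes the Dirac measure at $a$. Algorithm. Step 0: Choose $\alpha\in(0,1)$, a tolerance $\epsilon\ge0$, a probability measure $\nu$ supported on $\mathcal{F}$, and a degree for the polynomial lower approximating functions. Set $v^+=+\infty$, $v^-=-\infty$. Step 1: Solve the problem $\max_p \int_{\mathcal{F}}p\,d\nu$ subject to $F(x,y,\xi)-p(x,\xi)\in\mathscr{P}(K)$ (together with the constraints added in Step 3 of previous iterations) to get a polynomial $p(x,\xi)\in\mathbb{R}[x,\xi]$ of the given degree, feasible for this problem. Step 2: Let $\tilde{f}(x)=f_1(x)+\mathbb{E}_\mu[p(x,\xi)]$. Solve $\min_{x\in X}\tilde{f}(x)$ for a global optimal solution $\tilde{x}$. Update $v^-:=\max\{v^-,\tilde{f}(\tilde{x})\}$. If $v^+>f(\tilde{x})$, set $\tilde{x}^*:=\tilde{x}$ and $v^+:=f(\tilde{x})$. Step 3: If $v^+-v^-\le\epsilon$, set $\tilde{f}^*:=v^-$, stop, and output $(\tilde{x}^*,\tilde{f}^* )$. Otherwise, add to the problem of Step 1 the new constraint $f_1(\tilde{x})+\mathbb{E}_\mu[p(\tilde{x},\xi)]-\tilde{f}(\tilde{x})\ge0$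 on the unknown $p$ (with $\tilde{x}$ and the number $\tilde{f}(\tilde{x})$ taken from the current iteration), update $\nu:=\alpha\nu+(1-\alpha)(\delta_{\tilde{x}}\times\mu)$, and go back to Step 1. *)

(* Defs.v *)
From HB Require Import structures.
From mathcomp Require Import all_boot all_order all_algebra.
(* The notations of [mpoly] clash with those of MathComp-Analysis. *)
From mathcomp Require Import -(notations) mpoly.
From mathcomp Require Import all_classical all_reals all_analysis measurable_realfun.

Set Implicit Arguments.
Unset Strict Implicit.
Unset Printing Implicit Defensive.

Import Order.TTheory GRing.Theory Num.Theory.

Local Open Scope classical_set_scope.
Local Open Scope ring_scope.

(* [R^n] is [n.-tuple R], whose product sigma-algebra is the Borel one. *)
Notation polynomials n R := (mpoly.mpoly n R).
Notation peval p v := (mpoly.meval (tnth v) p).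

Section Embedding.
Context (R : realType) (n1 n2 n0 : nat).

(* The variables of R[x,xi] and R[x,y,xi] are numbered in the order displayed:
   x_i keeps its number and xi_k is moved past the block y. *)
Definition skip_y (i : 'I_(n1 + n0)) : 'I_(n1 + (n2 + n0)) :=
  match fintype.split i with
  | inl j => lshift (n2 + n0) j
  | inr k => rshift n1 (rshift n2 k)
  end.

Definition embed_xxi (p : polynomials (n1 + n0) R) :
    polynomials (n1 + (n2 + n0)) R :=
  mpoly.comp_mpoly [tuple mpoly.mpolyX R (mpoly.mnm1 (skip_y i)) | i < n1 + n0] p.

End Embedding.

(* [obj2] is the second-stage objective F, [law] the distribution mu of xi. *)
Record two_stage (R : realType) (n1 n2 n0 : nat) := TwoStage {
  idx0 : finType;
  idx1 : finType;
  idx2 : finType;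
  f1 : n1.-tuple R -> R;
  g0 : idx0 -> polynomials n0 R;
  g1 : idx1 -> polynomials n1 R;
  g2 : idx2 -> polynomials (n1 + (n2 + n0)) R;
  obj2 : polynomials (n1 + (n2 + n0)) R;
  law : probability (n0.-tuple R) R
}.

Arguments g0 {R n1 n2 n0} _ _.
Arguments g1 {R n1 n2 n0} _ _.
Arguments g2 {R n1 n2 n0} _ _.

(* The carrier [A] need not be measurable. *)
Definition supported_on d (T : measurableType d) (R : realType)
    (m : {measure set T -> \bar R}) (A : set T) : Prop :=
  m.-negligible (~` A).

Definition is_minimizer (R : realType) (T : Type) (A : set T) (h : T -> \bar R)
    (a : T) : Prop :=
  A a /\ forall b, A b -> (h a <= h b)%E.

(* The integral of [h] exists in [-oo, +oo]. *)
Definition has_integral d (T : measurableType d) (R : realType)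
    (m : {measure set T -> \bar R}) (h : T -> \bar R) : Prop :=
  measurable_fun [set: T] h /\
  ((\int[m]_t (h^\+ t) < +oo)%E \/ (\int[m]_t (h^\- t) < +oo)%E).

Section TwoStage.
Context (R : realType) (n1 n2 n0 : nat) (P : two_stage R n1 n2 n0).

Local Notation prob_xxi := (probability (n1.-tuple R * n0.-tuple R)%type R).

Definition feasX : set (n1.-tuple R) :=
  [set x | forall i, 0 <= peval (g1 P i) x].

Definition suppS : set (n0.-tuple R) :=
  [set xi | forall i, 0 <= peval (g0 P i) xi].

Definition feasY (x : n1.-tuple R) (xi : n0.-tuple R) : set (n2.-tuple R) :=
  [set y | forall i, 0 <= peval (g2 P i) (cat_tuple x (cat_tuple y xi))].

Definition f2 (x : n1.-tuple R) (xi : n0.-tuple R) : \bar R :=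
  ereal_inf [set (peval (obj2 P) (cat_tuple x (cat_tuple y xi)))%:E | y in feasY x xi].

Definition total_cost (x : n1.-tuple R) : \bar R :=
  ((f1 P x)%:E + \int[law P]_xi f2 x xi)%E.

Definition optimal_value : \bar R := ereal_inf [set total_cost x | x in feasX].

Definition setF : set (n1.-tuple R * n0.-tuple R) :=
  [set z | [/\ feasX z.1, suppS z.2 & feasY z.1 z.2 !=set0]].

Definition setK : set ((n1 + (n2 + n0)).-tuple R) :=
  [set w | exists x y xi, [/\ w = (cat_tuple x (cat_tuple y xi)),
                              setF (x, xi) & feasY x xi y]].

Definition nonneg_cone : set (polynomials (n1 + (n2 + n0)) R) :=
  [set q | forall w, setK w -> 0 <= peval q w].

(* The part of f~ or of a cut that depends on p: f_1(x) + E_mu[p(x, xi)]. *)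
Definition approx_cost (p : polynomials (n1 + n0) R) (x : n1.-tuple R) : \bar R :=
  ((f1 P x)%:E + 'E_(law P)[fun xi => peval p (cat_tuple x xi)])%E.

(* [incumbent] is [None] until the first assignment of x~*. A cut is a pair
   (x~, f~(x~)) recorded in Step 3. *)
Record alg_state := AlgState {
  nu : prob_xxi;
  cuts : seq (n1.-tuple R * \bar R);
  vplus : \bar R;
  vminus : \bar R;
  incumbent : option (n1.-tuple R)
}.

Definition init_state (nu0 : prob_xxi) :=
  AlgState nu0 [::] +oo%E -oo%E None.

(* Step 1 may return any feasible p, whatever its value of the objective
   \int_F p dnu; exact maximizers are a special case. Degree at most [deg] is
   [msize p <= deg.+1]. The last clause says that E_mu[p(x, xi)] is a
   well-defined real number. *)
Definition step1 (deg : nat) (s : alg_state) (p : polynomials (n1 + n0) R) : Prop :=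
  [/\ (mpoly.msize p <= deg.+1)%N,
      nonneg_cone (obj2 P - embed_xxi n2 p),
      forall c, c \in cuts s -> (0 <= approx_cost p c.1 - c.2)%E
    & forall x, feasX x -> (law P).-integrable [set: n0.-tuple R]
        (fun xi => (peval p (cat_tuple x xi))%:E)].

Definition step2_update (s : alg_state) (p : polynomials (n1 + n0) R)
    (xt : n1.-tuple R) : alg_state :=
  let improves := (total_cost xt < vplus s)%E in
  AlgState (nu s) (cuts s)
    (if improves then total_cost xt else vplus s)
    (maxe (vminus s) (approx_cost p xt))
    (if improves then Some xt else incumbent s).

(* [s'] is the state after Steps 1 and 2, entered with state [s], with choices
   [p] and [xt]. *)
Definition steps12 (deg : nat) (s : alg_state) (p : polynomials (n1 + n0) R)
    (xt : n1.-tuple R) (s' : alg_state) : Prop :=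
  [/\ step1 deg s p, is_minimizer feasX (approx_cost p) xt
    & s' = step2_update s p xt].

Definition stop_test (eps : R) (s : alg_state) : Prop :=
  (vplus s - vminus s <= eps%:E)%E.

Definition is_nu_update (alpha : R) (xt : n1.-tuple R)
    (nu_old nu_new : prob_xxi) : Prop :=
  forall A, measurable A ->
    nu_new A = (alpha%:E * nu_old A
                + (1 - alpha)%:E * (\d_xt \x law P) A)%E.

(* States in which some run of the algorithm enters Step 1. *)
Inductive reachable (alpha eps : R) (deg : nat) : alg_state -> Prop :=
| reach_init (nu0 : prob_xxi) :
    supported_on nu0 setF -> reachable alpha eps deg (init_state nu0)
| reach_next s p xt s' (nu' : prob_xxi) :
    reachable alpha eps deg s ->
    steps12 deg s p xt s' ->
    ~ stop_test eps s' ->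
    is_nu_update alpha xt (nu s') nu' ->
    reachable alpha eps deg
      (AlgState nu' ((xt, approx_cost p xt) :: cuts s')
                (vplus s') (vminus s') (incumbent s')).

Definition terminates_with (alpha eps : R) (deg : nat)
    (xstar : n1.-tuple R) (fstar : \bar R) : Prop :=
  exists s p xt s',
    [/\ reachable alpha eps deg s, steps12 deg s p xt s', stop_test eps s',
        incumbent s' = Some xstar & vminus s' = fstar].

End TwoStage.

(* Main.v *)
(** Each [p] found in Step 1 satisfies [p(x, xi) <= f_2(x, xi)] on [X * S]:
    trivially when [Y(x, xi)] is empty, and otherwise because [F - p] is
    nonnegative on [K]. Integrating, [f~ <= f] on [X], so every [min f~], hence
    [v^-], is a lower bound of the optimal value, while [v^+] is the cost of the
    feasible incumbent, hence an upper bound. At termination both bounds are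
    finite and differ by at most [eps]. *)
Require Import Defs.
From mathcomp Require Import all_boot all_order all_algebra.
From mathcomp Require Import -(notations) mpoly.
From mathcomp Require Import all_classical all_reals all_analysis measurable_realfun.


Import Order.TTheory GRing.Theory Num.Theory.

Local Open Scope classical_set_scope.
Local Open Scope ring_scope.

(** No integrability is assumed: positive and negative parts are compared separately, and
    subtraction in [\bar R] is monotone even at infinite values. *)
Lemma ae_le_integral d (T : measurableType d) (R : realType)
    (mu : {measure set T -> \bar R}) (f g : T -> \bar R) :
  measurable_fun [set: T] f -> measurable_fun [set: T] g ->
  {ae mu, forall t, (f t <= g t)%E} -> (\int[mu]_t f t <= \int[mu]_t g t)%E.
Proof.
move=> mf mg fg; rewrite integralE [leRHS]integralE; apply: leeB.
- apply: ae_ge0_le_integral => //; [exact: measurable_funepos..|].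
  (* The singleton domain turns the inequality at the single point [t] into one on a whole set. *)
  apply: filterS fg => t fgt _; apply: (funepos_le (D := [set t])) (mem_set _) => //.
  by move=> u /set_mem ->.
- apply: ae_ge0_le_integral => //; [exact: measurable_funeneg..|].
  apply: filterS fg => t fgt _; apply: (funeneg_le (D := [set t])) (mem_set _) => //.
  by move=> u /set_mem ->.
Qed.

Lemma peval_embed_xxi {R : realType} {n1 n2 n0 : nat}
    (p : polynomials (n1 + n0) R)
    (x : n1.-tuple R) (y : n2.-tuple R) (xi : n0.-tuple R) :
  peval (embed_xxi n2 p) (cat_tuple x (cat_tuple y xi)) =
  peval p (cat_tuple x xi).
Proof.
rewrite /embed_xxi comp_mpoly_meval; apply: meval_eq => i.
rewrite tnth_mktuple mevalXU /skip_y.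
by case: (fintype.split_ordP i) => [j|k] ->; rewrite ?tnth_lshift ?tnth_rshift.
Qed.

Section LowerApproximation.
Context {R : realType} {n1 n2 n0 : nat} (P : two_stage R n1 n2 n0).

Lemma lower_approx_le_f2 (p : polynomials (n1 + n0) R) x xi :
  nonneg_cone P (obj2 P - embed_xxi n2 p) -> feasX P x -> suppS P xi ->
  ((peval p (cat_tuple x xi))%:E <= f2 P x xi)%E.
Proof.
move=> cone_p Xx Sxi; apply: le_ereal_inf_tmp => _ [y Yy <-].
rewrite lee_fin -subr_ge0 -(peval_embed_xxi p x y xi) -mevalB.
(* The point [y] itself witnesses that [Y(x, xi)] is nonempty, as membership in [setF] demands. *)
by apply: cone_p; exists x, y, xi; split=> //; split=> //; exists y.
Qed.

(** Serves to exclude the value [-oo], both for the cost of an incumbent and for the final [v^-]. *)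
Lemma approx_cost_fin_num {deg : nat} {s : alg_state R n1 n0} {p x} :
  step1 P deg s p -> feasX P x -> approx_cost P p x \is a fin_num.
Proof.
move=> [_ _ _ int_p] Xx.
by rewrite /approx_cost fin_numD /= unlock; apply: integrable_fin_num (int_p x Xx).
Qed.

Hypothesis law_supp : supported_on (law P) (suppS P).
Hypothesis f2_integral : forall x, feasX P x -> has_integral (law P) (f2 P x).

Lemma approx_cost_le_total_cost {deg : nat} {s : alg_state R n1 n0} {p x} :
  step1 P deg s p -> feasX P x -> (approx_cost P p x <= total_cost P x)%E.
Proof.
move=> [_ cone_p _ int_p] Xx; apply: leeD2l; rewrite unlock.
apply: ae_le_integral.
- exact: measurable_int (int_p x Xx).
- by have [] := f2_integral _ Xx.
- apply: negligibleS law_supp => xi /=; apply: contra_not => Sxi.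
  exact: lower_approx_le_f2.
Qed.

(* The finiteness of the recorded cost excludes incumbents of infinite cost,
   for which [v^+ - v^-] would not control the gap. *)
Definition valid_bounds (s : alg_state R n1 n0) : Prop :=
  (vminus s <= optimal_value P)%E /\
  forall x, incumbent s = Some x ->
    [/\ feasX P x, vplus s = total_cost P x & total_cost P x \is a fin_num].

Lemma steps12_valid_bounds {deg : nat} {s p xt s'} :
  valid_bounds s -> steps12 P deg s p xt s' -> valid_bounds s'.
Proof.
move=> [lb ub] [st1 [Xxt min_xt] ->]; split=> /=.
  rewrite ge_max lb /=; apply: le_ereal_inf_tmp => _ [x Xx <-].
  exact: le_trans (min_xt x Xx) (approx_cost_le_total_cost st1 Xx).
case: ifPn => [improves|_] x; last exact: ub.
(* Strict improvement on [v^+] keeps the new cost below [+oo]; the finite minorant [f~(x~)] keeps it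
   above [-oo]. *)
move=> [<-]; split=> //; rewrite fin_numElt (lt_le_trans improves (leey _)) andbT.
apply: lt_le_trans (approx_cost_le_total_cost st1 Xxt).
by have := approx_cost_fin_num st1 Xxt; rewrite fin_numElt => /andP[].
Qed.

(** The bounds start at [-oo] with no incumbent, and Step 3 preserves every field that the invariant
    constrains. *)
Lemma reachable_valid_bounds {alpha eps : R} {deg : nat} {s} :
  reachable P alpha eps deg s -> valid_bounds s.
Proof.
elim=> [nu0 _|{}s p xt s' nu' _ vs st _ _]; first by split; rewrite ?leNye.
by have [] := steps12_valid_bounds vs st.
Qed.

End LowerApproximation.

Theorem proposition3p2 (R : realType) (n1 n2 n0 : nat) (P : two_stage R n1 n2 n0)
    (law_supp : supported_on (law P) (suppS P))
    (f2_integral : forall x, feasX P x -> has_integral (law P) (f2 P x))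
    (alpha eps : R) (alpha_gt0 : 0 < alpha) (alpha_lt1 : alpha < 1)
    (eps_ge0 : 0 <= eps) (deg : nat)
    (fopt : \bar R) (fopt_def : fopt = optimal_value P)
    (xstar : n1.-tuple R) (fstar : \bar R)
    (run : terminates_with P alpha eps deg xstar fstar) :
  [/\ (fstar <= fopt)%E /\ (fopt <= fstar + eps%:E)%E,
      (total_cost P xstar - eps%:E <= fopt)%E /\ (fopt <= total_cost P xstar)%E
    & eps = 0 -> fopt = fstar /\ is_minimizer (feasX P) (total_cost P) xstar].
Proof.
have [s [p [xt [s' [reach_s st stop inc <-]]]]] := run.
have vs := reachable_valid_bounds P law_supp f2_integral reach_s.
have [lb ub] := steps12_valid_bounds P law_supp f2_integral vs st.
have [Xx vplusE total_fin] := ub _ inc.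
have opt_le x : feasX P x -> (fopt <= total_cost P x)%E.
  by move=> Fx; rewrite fopt_def; apply: ereal_inf_lbound; exists x.
move: lb; rewrite -fopt_def => lb.
(* Finiteness lets [v^-] change sides in the stopping test: it is at least the last [f~(x~)] and at
   most the finite cost of [xstar]. *)
have vminus_fin : vminus s' \is a fin_num.
  rewrite fin_numElt; apply/andP; split.
    have [st1 [Xxt _] ->] := st; rewrite /= lt_max; apply/orP; right.
    by have := approx_cost_fin_num P st1 Xxt; rewrite fin_numElt => /andP[].
  apply: le_lt_trans lb (le_lt_trans (opt_le _ Xx) _).
  by move: total_fin; rewrite fin_numElt => /andP[].
have gap : (total_cost P xstar <= vminus s' + eps%:E)%E.
  by rewrite -leeBlDl// -vplusE.
have total_le : (total_cost P xstar - eps%:E <= fopt)%E.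
  by rewrite leeBlDr//; apply: le_trans gap _; exact: leeD2r.
split; [split=> //|split=> //; exact: opt_le|].
  exact: le_trans (opt_le _ Xx) gap.
(* Now [v^-], [fopt] and the cost of [xstar] all coincide. *)
move=> eps0; move: gap total_le; rewrite eps0 adde0 sube0 => gap total_le.
split; first by apply/le_anti; rewrite lb andbT (le_trans (opt_le _ Xx) gap).
by split=> // x Fx; apply: le_trans total_le (opt_le _ Fx).
Qed.
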